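(* Let $p$ be an odd prime and let $G$ be a finite $p$-group. If the nilpotency class of $G$ is less than or equal to $p^2-1$, then $\exp(G\wedge G)$ divides $p\exp(G)$. In particular, $\exp(H_2(G,\mathbb{Z}))$ divides $p\exp(G)$.
   Context: $\exp(H)$ denotes the exponent of a finite group $H$, i.e. the least positive integer $e$ with $h^e=1$ for all $h\in H$. $G\wedge G$ is the nonabelian exterior square of $G$: the group generated by symbols $g\wedge h$ ($g,h\in G$) subject to the relations $gg'\wedge h=({}^{g}g'\wedge {}^{g}h)(g\wedge h)$, $g\wedge hh'=(g\wedge h)({}^{h}g\wedge {}^{h}h')$ and $g\wedge g=1$ for all $g,g',h,h'\in G$, where ${}^{g}h=ghg^{-1}$. For finite $G$ it is isomorphic to the commutator subgroup $\gamma_2(H)$ of any covering group $H$ of $G$. $H_2(G,\mathbb{Z})$ is the second integral homology group (Schur multiplier) of $G$, which is isomorphic to the kernel of the commutator map $G\wedge G\to G$, $g\wedge h\mapsto ghg^{-1}h^{-1}$. *)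

(* Defs.v *)
From HB Require Import structures.
From mathcomp Require Import all_boot all_order all_algebra.
From mathcomp Require Import all_fingroup all_solvable.
From mathcomp Require Import boolp zify.

Set Implicit Arguments.
Unset Strict Implicit.
Unset Printing Implicit Defensive.

Import GRing.Theory.

(* [repr] alone is fingroup's choice of a set representative. *)
Local Notation qrepr := generic_quotient.repr.

(* Exponents.  The library's [exponent] only covers sets in a finite ambient
   group.  Here the value is 0 when no positive exponent exists, so that
   [group_exponent H %| n] with [0 < n] does assert that the exponent of H is
   finite. *)

Definition least_positive (P : nat -> Prop) : nat :=
  if pselect (exists n, (0 < n) && `[< P n >]) is left exP
  then ex_minn exP else 0.

Definition group_exponent (H : groupType) : nat :=
  least_positive (fun e => forall h : H, (h ^+ e = 1)%g).

Definition zmod_exponent (A : zmodType) : nat :=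
  least_positive (fun e => forall a : A, (a *+ e = 0)%R).

(* The group presented by generators X and relations u = v for [R u v].  A
   letter [(x, false)] stands for x and [(x, true)] for its inverse. *)

Section Presentation.

Variable X : choiceType.

Definition word : Type := seq (X * bool).
HB.instance Definition _ := Choice.on word.

Variable R : word -> word -> Prop.

Inductive word_eq : word -> word -> Prop :=
| word_eq_rel u v : R u v -> word_eq u v
| word_eq_cancel x b : word_eq [:: (x, b); (x, ~~ b)] [::]
| word_eq_cat u u' v v' :
    word_eq u u' -> word_eq v v' -> word_eq (u ++ v) (u' ++ v')
| word_eq_refl u : word_eq u u
| word_eq_sym u v : word_eq u v -> word_eq v u
| word_eq_trans u v w : word_eq u v -> word_eq v w -> word_eq u w.

Definition word_eqb : rel word := fun u v => `[< word_eq u v >].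

Lemma word_eqb_is_equiv : equiv_class_of word_eqb.
Proof.
split=> [u|u v|v u w].
- exact/asboolP/word_eq_refl.
- by apply/asboolP/asboolP; apply: word_eq_sym.
- by move=> /asboolP uv /asboolP vw; apply/asboolP/(word_eq_trans uv vw).
Qed.

Canonical word_eqb_equiv := EquivRelPack word_eqb_is_equiv.
Canonical word_eqb_encModRel := defaultEncModRel word_eqb.

Definition presented := {eq_quot word_eqb}%qT.
HB.instance Definition _ : EqQuotient word word_eqb presented :=
  EqQuotient.on presented.
HB.instance Definition _ := Choice.on presented.

Definition word_inv (u : word) : word := rev [seq (l.1, ~~ l.2) | l <- u].

Definition presented_class (u : word) : presented := (\pi_presented u)%qT.
Definition presented_one : presented := presented_class [::].
Definition presented_mul (a b : presented) : presented :=
  presented_class (qrepr a ++ qrepr b).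
Definition presented_inv (a : presented) : presented :=
  presented_class (word_inv (qrepr a)).

Lemma presented_classP u v :
  presented_class u = presented_class v <-> word_eq u v.
Proof.
split; first by move=> /eqmodP/asboolP.
by move=> uv; apply/eqmodP/asboolP.
Qed.

Lemma repr_presented_class u : word_eq (qrepr (presented_class u)) u.
Proof. by apply/presented_classP; rewrite /presented_class reprK. Qed.

Lemma presented_classK a : presented_class (qrepr a) = a.
Proof. exact: reprK. Qed.

Lemma presented_mulE u v :
  presented_mul (presented_class u) (presented_class v) =
  presented_class (u ++ v).
Proof. by apply/presented_classP/word_eq_cat; apply: repr_presented_class. Qed.

Lemma word_invK : involutive word_inv.
Proof.
move=> u; rewrite /word_inv map_rev revK -map_comp map_id_in //.
by case=> x b _ /=; rewrite negbK.
Qed.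

Lemma word_inv_r u : word_eq (u ++ word_inv u) [::].
Proof.
elim: u => [|[x b] u IHu] /=; first exact: word_eq_refl.
rewrite /word_inv /= rev_cons -cats1 catA -/(word_inv u).
apply: word_eq_trans (word_eq_cancel x b).
rewrite -[(x, b) :: _]/([:: (x, b)] ++ ((u ++ word_inv u) ++ [:: (x, ~~ b)])).
apply: (word_eq_cat (word_eq_refl _)).
exact: (word_eq_cat IHu (word_eq_refl _)).
Qed.

Lemma presented_mulA : associative presented_mul.
Proof.
move=> a b c.
by rewrite -(presented_classK a) -(presented_classK b) -(presented_classK c)
           !presented_mulE catA.
Qed.

Lemma presented_mul1g : left_id presented_one presented_mul.
Proof. by move=> a; rewrite -(presented_classK a) presented_mulE. Qed.

Lemma presented_mulg1 : right_id presented_one presented_mul.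
Proof. by move=> a; rewrite -(presented_classK a) presented_mulE cats0. Qed.

Lemma presented_mulgV :
  right_inverse presented_one presented_inv presented_mul.
Proof.
move=> a; rewrite -{1}(presented_classK a) presented_mulE.
exact/presented_classP/word_inv_r.
Qed.

Lemma presented_mulVg :
  left_inverse presented_one presented_inv presented_mul.
Proof.
move=> a; rewrite -{2}(presented_classK a) presented_mulE.
by apply/presented_classP; rewrite -{2}(word_invK (qrepr a)); apply: word_inv_r.
Qed.

HB.instance Definition _ := isGroup.Build presented
  presented_mulA presented_mul1g presented_mulg1 presented_mulVg
  presented_mulgV.

End Presentation.

Section ExteriorSquare.

Variable T : groupType.
Local Open Scope group_scope.

(* The library's [h ^ g] is the right conjugate g^-1 * h * g. *)
Definition lconj (g h : T) : T := g * h * g^-1.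

Definition wedge_word (g h : T) : word (T * T)%type := [:: ((g, h), false)].

Inductive wedge_rel : word (T * T)%type -> word (T * T)%type -> Prop :=
| wedge_rel_mull g g' h :
    wedge_rel (wedge_word (g * g') h)
              (wedge_word (lconj g g') (lconj g h) ++ wedge_word g h)
| wedge_rel_mulr g h h' :
    wedge_rel (wedge_word g (h * h'))
              (wedge_word g h ++ wedge_word (lconj h g) (lconj h h'))
| wedge_rel_diag g : wedge_rel (wedge_word g g) [::].

Definition exterior_square : groupType := presented wedge_rel.

End ExteriorSquare.

(* H_2(G, Z), computed from the (unnormalised, inhomogeneous) bar complex with
   trivial coefficients; since gT is finite, the free abelian group on gT^n is
   the group of all integer-valued functions on gT^n. *)

Section SecondHomology.

Variable gT : finGroupType.
Local Open Scope ring_scope.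

Definition free_ab (I : finType) : zmodType := {ffun I -> int}.

Definition free_gen (I : finType) (i : I) : free_ab I :=
  [ffun j => (j == i)%:R].

Definition free_ext (I : finType) (A : zmodType) (f : I -> A) (c : free_ab I) :
  A := \sum_i f i *~ c i.

Definition bar1 := free_ab gT.
Definition bar2 := free_ab (gT * gT)%type.
Definition bar3 := free_ab (gT * gT * gT)%type.

Definition bar_d2 : bar2 -> bar1 :=
  free_ext (fun t => let: (g, h) := t in
    free_gen h - free_gen (g * h)%g + free_gen g).

Definition bar_d3 : bar3 -> bar2 :=
  free_ext (fun t => let: (g, h, k) := t in
    free_gen (h, k) - free_gen ((g * h)%g, k) + free_gen (g, (h * k)%g)
    - free_gen (g, h)).

Lemma free_ext_is_zmod_morphism (I : finType) (A : zmodType) (f : I -> A) :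
  zmod_morphism (free_ext f).
Proof.
move=> c d; rewrite /free_ext -sumrB; apply: eq_bigr => i _.
by rewrite !ffunE mulrzBr.
Qed.

HB.instance Definition _ (I : finType) (A : zmodType) (f : I -> A) :=
  GRing.isZmodMorphism.Build (free_ab I) A (free_ext f)
    (free_ext_is_zmod_morphism f).
HB.instance Definition _ := GRing.Additive.on bar_d2.
HB.instance Definition _ := GRing.Additive.on bar_d3.

Lemma free_ext_gen (I : finType) (A : zmodType) (f : I -> A) i :
  free_ext f (free_gen i) = f i.
Proof.
rewrite /free_ext (bigD1 i) //= big1 ?addr0 ?ffunE ?eqxx // => j /negPf ji.
by rewrite ffunE ji.
Qed.

Lemma bar_d2_d3 b : bar_d2 (bar_d3 b) = 0.
Proof.
rewrite [bar_d3 b]/free_ext raddf_sum big1 // => -[[g h] k] _.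
rewrite raddfMz !(raddfB, raddfD) /= /bar_d2 !free_ext_gen mulgA.
set a := free_gen k; set b1 := free_gen (h * k)%g; set c := free_gen h.
set d := free_gen (g * h * k)%g; set e := free_gen (g * h)%g.
set f := free_gen g.
suff -> : a - b1 + c - (a - d + e) + (b1 - d + f) - (c - e + f) = 0.
  by rewrite mul0rz.
by apply/ffunP=> x; rewrite !ffunE; lia.
Qed.

Definition is_cycle2 : pred bar2 := fun c => bar_d2 c == 0.

Lemma is_cycle2_zmod_closed : zmod_closed is_cycle2.
Proof.
split=> [|c d]; rewrite !unfold_in /is_cycle2; first by rewrite raddf0.
by rewrite raddfB /= => /eqP-> /eqP->; rewrite subrr.
Qed.
HB.instance Definition _ :=
  GRing.isZmodClosed.Build bar2 is_cycle2 is_cycle2_zmod_closed.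

Record cycle2 := Cycle2 { cycle2_val :> bar2; _ : cycle2_val \in is_cycle2 }.
HB.instance Definition _ := [isSub for cycle2_val].
HB.instance Definition _ := [Choice of cycle2 by <:].
HB.instance Definition _ := [SubChoice_isSubZmodule of cycle2 by <:].

Definition is_boundary2 : pred cycle2 :=
  fun c => `[< exists b, bar_d3 b = val c >].

Lemma is_boundary2_zmod_closed : zmod_closed is_boundary2.
Proof.
split=> [|c d]; rewrite !unfold_in.
  by apply/asboolP; exists 0; rewrite !raddf0.
move=> /asboolP[b bc] /asboolP[b' b'd]; apply/asboolP.
by exists (b - b'); rewrite raddfB /= bc b'd.
Qed.
HB.instance Definition _ :=
  GRing.isZmodClosed.Build cycle2 is_boundary2 is_boundary2_zmod_closed.

Definition homology2 : zmodType :=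
  Quotient.quot (GRing.ZmodClosed.clone cycle2 is_boundary2 _).

End SecondHomology.

(* Main.v *)
Require Import Defs.
From HB Require Import structures.
From mathcomp Require Import all_boot all_order all_algebra.
From mathcomp Require Import all_fingroup all_solvable.
From mathcomp Require Import boolp zify.

(** Write G for the p-group, q for its exponent and M_i for the subgroup of
G ^ G generated by the h ^ g with h in G and g in the i-th term of the lower
central series; M_1 is all of G ^ G, and M_(p^2) is trivial because G has
class at most p^2 - 1.

The crossed module structure (G acts on G ^ G, and the commutator map
G ^ G -> G satisfies the Peiffer identity [peiffer]) gives the calculus that a
covering group would give: k ^ [a, b] measures how k moves a ^ b
([wedge_bdr]).  It follows that [M_i, M_j] lies in M_(i+j)
([wedge_filt_N_series]).

The arithmetic input is the Hall-Petresco formula: if g : nat -> G ^ G is a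
polynomial sequence for the filtration M_0, M_i, M_2i, ... and g(0) = 1, then
g(n) is g(1)^n times a product of e_j^(C(n,j)), j >= 2, with e_j in M_ij.  It
is obtained here from the fact that polynomial sequences form a group
([poly_upto_closed], [hall_petresco]).  Apply it to n |-> y ^ x^n with x in the
i-th term of the lower central series.  When q divides n the left-hand side is
1, so (y ^ x)^n is a product of powers e_j^(C(n,j)); another application, to
n |-> (ab)^n b^-n a^-n, shows that the n-th power is multiplicative on M_i as
soon as all these e_j^(C(n,j)) vanish.  So M_i has exponent dividing n whenever
C(n,j) kills M_ij for all j >= 2 ([wedge_filt_expg]).

This is used twice, by descending induction on i ([exponent_bound]).  First
take n = q and i >= p: for j < p the binomial C(q,j) is divisible by q and M_ij
is deeper than M_i, while for j >= p the group M_ij is trivial; hence M_p has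
exponent dividing q.  Then take n = pq and i >= 1: for j < p, C(pq,j) is
divisible by pq, for p <= j < p^2 it is divisible by q and M_ij lies in M_p,
and for j >= p^2 the group M_ij is trivial.  Hence pq kills M_1.

For the second homology group, let A be the group of 2-chains modulo
boundaries.  The tautological cocycle G x G -> A defines a central extension H
of G by A.  Sending g ^ h to the commutator of lifts of g and h defines a map
from G ^ G to H ([exterior_lift_exists]).  Its image C contains all commutators
of H and is killed by pq.  In the abelian group H / C the class of a 2-chain
only depends on its boundary, so a cycle lies in C ([cocycle_cycle_mulrn]), and
pq times it is a boundary. *)

Set Implicit Arguments.
Unset Strict Implicit.
Unset Printing Implicit Defensive.

Import GRing.Theory.

Local Open Scope group_scope.

(** Free reduction of both sides of an equation between group words. *)
Ltac group_eq :=
  rewrite ?commgEl /conjg;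
  rewrite ?(invMg, invgK, invg1, mulgA, mul1g, mulg1);
  repeat progress rewrite ?(mulgK, mulgVK, mulgV, mulVg, mul1g, mulg1);
  try done.

(** * Subgroups of possibly infinite groups *)

Section Subgroups.
Variable K : groupType.
Implicit Types (D X : K -> Prop) (x y : K).

Definition is_subgroup D :=
  [/\ D 1, forall x y, D x -> D y -> D (x * y) & forall x, D x -> D x^-1].

Inductive generated_by X : K -> Prop :=
| generated_in x of X x : generated_by X x
| generated1 : generated_by X 1
| generatedM x y of generated_by X x & generated_by X y : generated_by X (x * y)
| generatedV x of generated_by X x : generated_by X x^-1.

Lemma generated_subgroup X : is_subgroup (generated_by X).
Proof.
by split; [apply: generated1 | apply: generatedM | apply: generatedV].
Qed.

Lemma generated_min X D :
  is_subgroup D -> (forall x, X x -> D x) ->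
  forall x, generated_by X x -> D x.
Proof.
move=> [D1 DM DV] XD x; elim=> {x} [x /XD //||x y _ Dx _ Dy|x _ Dx] //.
- exact: DM.
- exact: DV.
Qed.

Lemma subgroupX D x n : is_subgroup D -> D x -> D (x ^+ n).
Proof.
move=> [D1 DM _] Dx; elim: n => [|n IHn]; first by rewrite expg0.
by rewrite expgS; apply: DM.
Qed.

End Subgroups.

(** * Polynomial sequences and the Hall-Petresco formula *)

Section PolynomialSequences.
Variables (K : groupType) (F : nat -> K -> Prop).

Definition N_series :=
  [/\ forall i, is_subgroup (F i), forall i x, F i.+1 x -> F i x
    & forall i j x y, F i x -> F j y -> F (i + j)%N [~ x, y]].

Definition diff_seq (g : nat -> K) (n : nat) : K := (g n)^-1 * g n.+1.

(** Polynomial sequences of level [i], tested only up to the [r]-th derivative: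
the k-th derivative takes values in [F (i + k)] for all k <= r.  The bound [r]
is what makes the closure properties provable by a plain induction. *)
Fixpoint poly_upto (r i : nat) (g : nat -> K) : Prop :=
  (forall n, F i (g n)) /\
  (if r is r'.+1 then poly_upto r' i.+1 (diff_seq g) else True).

Lemma poly_upto_ext r i g h : g =1 h -> poly_upto r i g -> poly_upto r i h.
Proof.
elim: r i g h => [|r IHr] i g h gh [Fg dg]; split=> //;
  try by move=> n; rewrite -gh.
by apply: IHr dg => n; rewrite /diff_seq !gh.
Qed.

Lemma poly_upto_val r i g n : poly_upto r i g -> F i (g n).
Proof. by case: r => [|r] /= []. Qed.

Lemma poly_upto_pred r i g : poly_upto r.+1 i g -> poly_upto r i g.
Proof.
elim: r i g => [|r IHr] i g [Fg dg]; split=> //.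
exact: IHr dg.
Qed.

Hypothesis serF : N_series.
Let F1 i : F i 1. Proof. by have [/(_ i) []] := serF. Qed.
Let FM i x y : F i x -> F i y -> F i (x * y).
Proof. by have [/(_ i) [_ h _] _ _] := serF; apply: h. Qed.
Let FV i x : F i x -> F i x^-1.
Proof. by have [/(_ i) [_ _ h] _ _] := serF; apply: h. Qed.
Let FS i x : F i.+1 x -> F i x. Proof. by have [_ h _] := serF; apply: h. Qed.
Let FR i j x y : F i x -> F j y -> F (i + j)%N [~ x, y].
Proof. by have [_ _ h] := serF; apply: h. Qed.

Lemma poly_upto_weaken r i k g : poly_upto r (i + k) g -> poly_upto r i g.
Proof.
elim: k i => [|k IHk] i; first by rewrite addn0.
rewrite -addSnnS => /IHk {IHk}.
elim: r i g => [|r IHr] i g [Fg dg]; split=> //.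
- by move=> n; apply: FS.
- by move=> n; apply: FS.
exact: IHr.
Qed.

(** Lazard's theorem that polynomial sequences form a group filtered by level.
The derivative of a product, an inverse or a commutator is a product of
sequences, their derivatives and commutators of these, all of which the
induction hypothesis at [r] places at level one higher; as these operations
get mixed, the three claims need each other. *)
Lemma poly_upto_closed r :
  [/\ forall i g h, poly_upto r i g -> poly_upto r i h ->
        poly_upto r i (fun n => g n * h n),
      forall i g, poly_upto r i g -> poly_upto r i (fun n => (g n)^-1)
    & forall i j g h, poly_upto r i g -> poly_upto r j h ->
        poly_upto r (i + j) (fun n => [~ g n, h n])].
Proof.
elim: r => [|r [IHM IHV IHR]].
  split=> [i g h [Fg _] [Fh _]|i g [Fg _]|i j g h [Fg _] [Fh _]];
    by split=> // n; auto.
have IHRl i j k g h (ijk : (k <= i + j)%N) :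
    poly_upto r i g -> poly_upto r j h -> poly_upto r k (fun n => [~ g n, h n]).
  move=> pg ph; apply: (@poly_upto_weaken _ _ (i + j - k)).
  by rewrite subnKC //; apply: IHR.
split.
- move=> i g h pg ph.
  have [[Fg dg] [Fh dh]] := (pg, ph); split=> [n|]; first by auto.
  (* with g' = g dg and h' = h dh, h^-1 g^-1 g' h' = dg [dg, h] dh *)
  apply: (@poly_upto_ext _ _
    (fun n => diff_seq g n * [~ diff_seq g n, h n] * diff_seq h n)).
    by move=> n; rewrite /diff_seq; group_eq.
  apply: (IHM) dh; apply: (IHM) (dg) _.
  by apply: IHRl dg (poly_upto_pred ph); lia.
- move=> i g pg; have [Fg dg] := pg; split=> [n|]; first by auto.
  apply: (@poly_upto_ext _ _
    (fun n => (diff_seq g n)^-1 * [~ (diff_seq g n)^-1, (g n)^-1])).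
    by move=> n; rewrite /diff_seq; group_eq.
  apply: (IHM); first exact: IHV.
  by apply: IHRl (IHV _ _ dg) (IHV _ _ (poly_upto_pred pg)); lia.
move=> i j g h pg ph.
have [[Fg dg] [Fh dh]] := (pg, ph); split=> [n|]; first by auto.
move/poly_upto_pred: pg => pg; move/poly_upto_pred: ph => ph.
(* with x = dg, y = dh and c = [g, h], the derivative of [g, h] is
   [g, y] [[g, y], c] [c, y] [w, x] [x, h y], w = [g, y] c [c, y] *)
pose c n := [~ g n, h n].
pose gy n := [~ g n, diff_seq h n].
pose w n := gy n * c n * [~ c n, diff_seq h n].
have pc : poly_upto r (i + j) c by apply: IHR.
have pgy : poly_upto r (i + j).+1 gy by apply: IHRl pg dh; lia.
have pcy : poly_upto r (i + j).+1 (fun n => [~ c n, diff_seq h n]).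
  by apply: IHRl pc dh; lia.
have pw : poly_upto r (i + j) w.
  apply: (IHM); last by apply: (@poly_upto_weaken _ _ 1); rewrite addn1.
  by apply: (IHM) pc; apply: (@poly_upto_weaken _ _ 1); rewrite addn1.
apply: (@poly_upto_ext _ _ (fun n =>
   gy n * [~ gy n, c n] * [~ c n, diff_seq h n] *
   [~ w n, diff_seq g n] * [~ diff_seq g n, h n * diff_seq h n])).
  move=> n; rewrite /w /gy /c /diff_seq; group_eq.
apply: (IHM); last first.
  apply: (@IHRl i.+1 j) => //; apply: (IHM) => //.
  by apply: (@poly_upto_weaken _ _ 1); rewrite addn1.
apply: (IHM); last by apply: (IHRl (i + j)%N i.+1) => //; lia.
apply: (IHM) => //; apply: (IHM) => //.
by apply: IHRl pgy pc; lia.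
Qed.

Lemma poly_uptoM r i g h :
  poly_upto r i g -> poly_upto r i h -> poly_upto r i (fun n => g n * h n).
Proof. by have [/(_ i g h)] := poly_upto_closed r. Qed.

Lemma poly_uptoV r i g : poly_upto r i g -> poly_upto r i (fun n => (g n)^-1).
Proof. by have [_ /(_ i g)] := poly_upto_closed r. Qed.

Lemma poly_upto1 r i : poly_upto r i (fun=> 1).
Proof.
elim: r i => [|r IHr] i; split=> //.
by apply: poly_upto_ext (IHr i.+1) => n; rewrite /diff_seq invg1 mulg1.
Qed.

Lemma poly_upto_bin r i k e :
  F (i + k) e -> poly_upto r i (fun n => e ^+ 'C(n, k)).
Proof.
have Fi i' k' m : F (i' + k') e -> F i' (e ^+ m).
  move=> Fe; apply: subgroupX; first by have [] := serF.
  by move: Fe; elim: k' => [|k' IHk]; rewrite ?addn0 // addnS => /FS.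
elim: r i k => [|r IHr] i k Fe; split=> //;
  try by move=> n; apply: (Fi _ k).
case: k Fe => [|k] Fe.
  apply: poly_upto_ext (poly_upto1 r i.+1) => n.
  by rewrite /diff_seq !bin0 expg1 mulVg.
apply: (@poly_upto_ext _ _ (fun n => e ^+ 'C(n, k))); last first.
  by apply: IHr; rewrite addSnnS.
by move=> n; rewrite /diff_seq binS expgnDr mulKg.
Qed.

(** If g vanishes at 0, ..., k - 1, its k-th derivative at 0 is g(k). *)
Lemma poly_upto_leading r i k g :
  poly_upto (r + k) i g -> (forall m, m < k -> g m = 1) -> F (i + k) (g k).
Proof.
elim: k i g => [|k IHk] i g; first by rewrite !addn0 => /poly_upto_val.
rewrite addnS => -[_ dg] g1.
have := IHk _ _ dg; rewrite /diff_seq (g1 k) // invg1 mul1g addSnnS.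
by apply=> m mk; rewrite !g1 ?invg1 ?mulg1 //; lia.
Qed.

(** Taylor expansion of g.  Dividing first by g(1)^m, a sequence h trivial at 0
and 1 remains.  If h is trivial below k >= 2, its value e at k is in [F k], so
dividing h by the polynomial sequence m |-> e^(C(m,k)) makes it trivial up to k
and, by assumption, does not change its value at n. *)
Theorem hall_petresco g n :
    (forall r, poly_upto r 0 g) -> g 0 = 1 ->
    (forall j e, (1 < j)%N -> F j e -> e ^+ 'C(n, j) = 1) ->
  g n = g 1%N ^+ n.
Proof.
move=> pg g0 vanish.
have F1g : F 1%N (g 1%N).
  by apply: (@poly_upto_leading 0 0 1%N) => // -[].
have kill d : forall k h, (1 < k)%N -> (n < k + d)%N ->
    (forall r, poly_upto r 0 h) -> (forall m, (m < k)%N -> h m = 1) -> h n = 1.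
  elim: d => [|d IHd] k h k1 nkd ph h1; first by apply: h1; rewrite -(addn0 k).
  have Fhk : F k (h k) by apply: (@poly_upto_leading 0 0 k).
  pose h' m := (h k ^+ 'C(m, k))^-1 * h m.
  have -> : h n = h' n by rewrite /h' (vanish k) // invg1 mul1g.
  apply: (IHd k.+1); [by lia | by lia | |].
    by move=> r; apply: poly_uptoM => //; apply/poly_uptoV/poly_upto_bin.
  move=> m; rewrite ltnS leq_eqVlt => /orP[/eqP->|mk].
    by rewrite /h' binn expg1 mulVg.
  by rewrite /h' bin_small // expg0 h1 // mulVg.
have gn : (g 1%N ^+ 'C(n, 1%N))^-1 * g n = 1.
  apply: (kill n 2 (fun m => (g 1%N ^+ 'C(m, 1%N))^-1 * g m)) => // [r|].
  - by apply: poly_uptoM => //; apply/poly_uptoV/poly_upto_bin.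
  - case=> [|[|m]] // _; rewrite bin1; first by rewrite expg0 g0 mulVg.
    by rewrite expg1 mulVg.
by rewrite -(mulKVg (g 1%N ^+ n) (g n)) -{2}(bin1 n) gn mulg1.
Qed.

End PolynomialSequences.

(** * Exponents of the terms of an N-series *)

Section ExponentBound.
Variables (K : groupType) (M : nat -> K -> Prop).
Hypothesis serM : N_series M.

Lemma N_series_le i j x : i <= j -> M j x -> M i x.
Proof.
move=> /subnKC <-; elim: (j - i)%N => [|k IHk]; rewrite ?addn0 // addnS.
by have [_ Mdec _] := serM; move/Mdec.
Qed.

Lemma N_series_multiples i : N_series (fun j => M (i * j)%N).
Proof.
have [Msub _ MR] := serM; split=> [j|j x|j k x y Mx My] //.
- by apply: N_series_le; rewrite leq_mul2l leqnSn orbT.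
- by rewrite mulnDr; apply: MR.
Qed.

Definition binomials_kill n i :=
  forall j x, (1 < j)%N -> M (i * j)%N x -> x ^+ 'C(n, j) = 1.

(** The Hall-Petresco formula for m |-> (xy)^m y^-m x^-m, whose value at 1 is
trivial. *)
Lemma expgM_kill n i x y : binomials_kill n i -> M i x -> M i y ->
  (x * y) ^+ n = x ^+ n * y ^+ n.
Proof.
move=> kill Mx My; have serF := N_series_multiples i.
have polyX z r : M i z ->
    poly_upto (fun j => M (i * j)%N) r 0 (fun n => z ^+ n).
  move=> Mz; apply: (@poly_upto_ext _ _ _ _ (fun n => z ^+ 'C(n, 1%N))).
    by move=> m; rewrite bin1.
  by apply: poly_upto_bin => //; rewrite muln1.
pose g m := (x * y) ^+ m * ((y ^+ m)^-1 * (x ^+ m)^-1).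
have Mxy : M i (x * y) by have [/(_ i) [_ MM _] _ _] := serM; apply: MM.
have : g n = g 1%N ^+ n.
  apply: (hall_petresco serF) kill => [r|]; last by rewrite /g !expg0; group_eq.
  apply: poly_uptoM => //; first exact: polyX.
  by apply: poly_uptoM => //; apply: poly_uptoV => //; apply: polyX.
have -> : g 1%N = 1 by rewrite /g !expg1 -invMg mulgV.
by rewrite expg1n /g -invMg => /mulg1_eq/invg_inj.
Qed.

End ExponentBound.

(** j C(n,j) = n C(n-1,j-1) is divisible by n, and j < p^(k+1) contributes at
most p^k. *)
Lemma dvdn_expn_bin p e k j : prime p -> (0 < j)%N -> (j < p ^ k.+1)%N ->
  p ^ e %| 'C(p ^ (e + k), j).
Proof.
move=> p_pr j0 jp; set n := (p ^ (e + k))%N.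
have [jn|nj] := leqP j n; last by rewrite bin_small.
have C0 : (0 < 'C(n, j))%N by rewrite bin_gt0.
rewrite pfactor_dvdn //.
have : p ^ (e + k) %| j * 'C(n, j).
  by rewrite -(prednK j0) -mul_bin_diag dvdn_mulr.
rewrite pfactor_dvdn ?muln_gt0 ?j0 // lognM //.
have : (p ^ logn p j <= j)%N by apply: dvdn_leq => //; apply: pfactor_dvdnn.
move=> /leq_ltn_trans/(_ jp); rewrite ltn_exp2l ?prime_gt1 //.
by lia.
Qed.

(** Two descending inductions: [p ^ e] kills [M i] for i >= p, where the only
binomials that matter are those below p, and then [p ^ e.+1] kills [M i] for
i >= 1, where the binomials C(p^(e+1), j) with p <= j < p^2 lose one factor p
but meet [M (i * j)] inside [M p]. *)
Theorem exponent_bound (K : groupType) (M : nat -> K -> Prop) p e :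
    prime p -> N_series M -> (forall x, M (p ^ 2)%N x -> x = 1) ->
    (forall i n, (0 < i)%N -> p ^ e %| n -> binomials_kill M n i ->
      forall x, M i x -> x ^+ n = 1) ->
  forall x, M 1%N x -> x ^+ (p ^ e.+1) = 1.
Proof.
move=> p_pr serM Mtriv step.
have p_gt0 := prime_gt0 p_pr.
have le := N_series_le serM.
have dvdkill n m x : n %| m -> x ^+ n = 1 -> x ^+ m = 1 :> K.
  by move=> /dvdnP[k ->] xn; rewrite mulnC expgnA xn expg1n.
have killp i x : (p <= i)%N -> M i x -> x ^+ (p ^ e) = 1.
  have [d] : exists d, (p ^ 2 <= i + d)%N by exists (p ^ 2)%N; rewrite leq_addl.
  elim: d i x => [|d IHd] i x; rewrite ?addn0 => id pi Mx.
    by rewrite (Mtriv x) ?expg1n //; apply: le Mx.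
  apply: (step i) Mx => //; first by lia.
  move=> j z j1 Mz; have [jp|pj] := ltnP j p.
    apply: (@dvdkill (p ^ e)%N).
      by have := @dvdn_expn_bin p e 0 j; rewrite addn0 expn1; apply=> //; lia.
    by apply: (IHd i.+1) => //; [lia | lia | apply: le Mz; nia].
  by rewrite (Mtriv z) ?expg1n //; apply: le Mz; rewrite -mulnn leq_mul.
suff H i x : (0 < i)%N -> M i x -> x ^+ (p ^ e.+1) = 1 by move=> x; apply: H.
have [d] : exists d, (p ^ 2 <= i + d)%N by exists (p ^ 2)%N; rewrite leq_addl.
elim: d i x => [|d IHd] i x; rewrite ?addn0 => id i0 Mx.
  by rewrite (Mtriv x) ?expg1n //; apply: le Mx.
apply: (step i) Mx => //; first by rewrite expnS dvdn_mull.
move=> j z j1 Mz; have [jp|pj] := ltnP j p.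
  apply: (@dvdkill (p ^ e.+1)%N).
    by have := @dvdn_expn_bin p e.+1 0 j; rewrite addn0 expn1; apply=> //; lia.
  by apply: (IHd i.+1) => //; [lia | apply: le Mz; nia].
have [jp2|p2j] := ltnP j (p ^ 2).
  apply: (@dvdkill (p ^ e)%N).
    by have := @dvdn_expn_bin p e 1 j; rewrite addn1; apply=> //; lia.
  by apply: killp Mz; nia.
by rewrite (Mtriv z) ?expg1n //; apply: le Mz; nia.
Qed.

(** * Maps out of a presented group *)

Section PresentedLift.
Variables (X : choiceType) (R : word X -> word X -> Prop).
Variables (K : groupType) (f : X -> K).

Definition letter_eval (l : X * bool) : K := if l.2 then (f l.1)^-1 else f l.1.
Definition word_eval (u : word X) : K := \prod_(l <- u) letter_eval l.

Lemma word_eval_cat u v : word_eval (u ++ v) = word_eval u * word_eval v.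
Proof. by rewrite /word_eval big_cat. Qed.

Lemma word_eval1 x : word_eval [:: (x, false)] = f x.
Proof. by rewrite /word_eval big_seq1. Qed.

Hypothesis fR : forall u v, R u v -> word_eval u = word_eval v.

Lemma word_eval_eq u v : word_eq R u v -> word_eval u = word_eval v.
Proof.
elim=> {u v} [u v /fR //|x b|u u' v v' _ eu _ ev|//|//|u v w _ -> _ ->//].
- rewrite /word_eval !big_cons big_nil mulg1 /letter_eval /=.
  by case: b => /=; rewrite ?mulVg ?mulgV.
- by rewrite !word_eval_cat eu ev.
Qed.

Definition presented_lift (a : presented R) : K :=
  word_eval (generic_quotient.repr a).

Lemma presented_lift_class u :
  presented_lift (presented_class R u) = word_eval u.
Proof. exact/word_eval_eq/repr_presented_class. Qed.

Lemma presented_liftM : {morph presented_lift : a b / a * b}.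
Proof.
move=> a b; rewrite -[a]presented_classK -[b]presented_classK.
rewrite [X in presented_lift X](presented_mulE R).
by rewrite !presented_lift_class word_eval_cat.
Qed.

Lemma presented_lift_gen x :
  presented_lift (presented_class R [:: (x, false)]) = f x.
Proof. by rewrite presented_lift_class word_eval1. Qed.

End PresentedLift.

Lemma presented_generated (X : choiceType) (R : word X -> word X -> Prop) a :
  generated_by (fun b => exists x, b = presented_class R [:: (x, false)]) a.
Proof.
rewrite -[a]presented_classK; elim: (generic_quotient.repr a) => [|[x b] u IHu].
  exact: generated1.
have -> : presented_class R ((x, b) :: u) =
          presented_class R [:: (x, b)] * presented_class R u.
  exact/esym/(presented_mulE R [:: (x, b)]).
apply: generatedM IHu; case: b; last by apply: generated_in; exists x.
have -> : presented_class R [:: (x, true)] =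
          (presented_class R [:: (x, false)])^-1.
  apply/esym/mulg1_eq; rewrite [LHS](presented_mulE R).
  exact/presented_classP/(word_eq_cancel _ x false).
by apply: generatedV; apply: generated_in; exists x.
Qed.

(** * The crossed module structure of the exterior square *)

Section ExteriorSquareCalculus.
Variable T : groupType.
Implicit Types (g h k : T).
Local Notation E := (exterior_square T).
Implicit Types (l m : E).

Definition wedge g h : E := presented_class (@wedge_rel T) (wedge_word g h).

Lemma lconj1g h : lconj 1 h = h. Proof. by rewrite /lconj; group_eq. Qed.
Lemma lconjM g h k : lconj g (h * k) = lconj g h * lconj g k.
Proof. by rewrite /lconj; group_eq. Qed.
Lemma lconjA g h k : lconj (g * h) k = lconj g (lconj h k).
Proof. by rewrite /lconj; group_eq. Qed.
Lemma lconjJ k g h : lconj k (lconj g h) = lconj (lconj k g) (lconj k h).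
Proof. by rewrite /lconj; group_eq. Qed.

Lemma wedgeMl_conj g g' h :
  wedge (g * g') h = wedge (lconj g g') (lconj g h) * wedge g h.
Proof.
rewrite /wedge [RHS](presented_mulE _ (wedge_word _ _)).
exact/presented_classP/word_eq_rel/wedge_rel_mull.
Qed.

Lemma wedgeMr_conj g h h' :
  wedge g (h * h') = wedge g h * wedge (lconj h g) (lconj h h').
Proof.
rewrite /wedge [RHS](presented_mulE _ (wedge_word _ _)).
exact/presented_classP/word_eq_rel/wedge_rel_mulr.
Qed.

Lemma wedge_diag g : wedge g g = 1.
Proof. exact/presented_classP/word_eq_rel/wedge_rel_diag. Qed.

Lemma exterior_ind (D : E -> Prop) :
  is_subgroup D -> (forall g h, D (wedge g h)) -> forall l, D l.
Proof.
move=> subD Dw l; apply: generated_min subD _ _ (presented_generated l).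
by move=> _ [[g h] ->]; apply: Dw.
Qed.

Lemma exterior_morph_eq (K : groupType) (f f' : E -> K) :
    {morph f : l m / l * m} -> {morph f' : l m / l * m} ->
    (forall g h, f (wedge g h) = f' (wedge g h)) ->
  f =1 f'.
Proof.
move=> fM f'M eqf; apply: (@exterior_ind (fun l => f l = f' l)) => //.
have morph1 (d : E -> K) : {morph d : l m / l * m} -> d 1 = 1.
  by move=> dM; apply: (mulgI (d 1)); rewrite -dM !mulg1.
have morphV (d : E -> K) l : {morph d : l m / l * m} -> d l^-1 = (d l)^-1.
  by move=> dM; apply/esym/mulg1_eq; rewrite -dM mulgV morph1.
split=> [|l m fl fm|l fl]; first by rewrite !morph1.
- by rewrite fM f'M fl fm.
- by rewrite !morphV // fl.
Qed.

Section Lift.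
Variables (K : groupType) (f : T -> T -> K).
Hypothesis fMl : forall g g' h,
  f (g * g') h = f (lconj g g') (lconj g h) * f g h.
Hypothesis fMr : forall g h h',
  f g (h * h') = f g h * f (lconj h g) (lconj h h').
Hypothesis fgg : forall g, f g g = 1.

Let f2 (x : T * T) := f x.1 x.2.

Lemma wedge_rel_eval u v : wedge_rel u v -> word_eval f2 u = word_eval f2 v.
Proof.
rewrite /wedge_word; case=> [g g' h|g h h'|g]; rewrite /wedge_word.
- by rewrite word_eval_cat !word_eval1; apply: fMl.
- by rewrite word_eval_cat !word_eval1; apply: fMr.
- by rewrite word_eval1 /word_eval big_nil; apply: fgg.
Qed.

Definition exterior_lift : E -> K := presented_lift f2.

Lemma exterior_liftM : {morph exterior_lift : l m / l * m}.
Proof. exact/presented_liftM/wedge_rel_eval. Qed.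

Lemma exterior_lift_wedge g h : exterior_lift (wedge g h) = f g h.
Proof. exact: (presented_lift_gen wedge_rel_eval (g, h)). Qed.

End Lift.

(** The action of T on its exterior square. *)
Definition wact k : E -> E :=
  exterior_lift (fun g h => wedge (lconj k g) (lconj k h)).
(** The commutator map; g h g^-1 h^-1 is grouped as g times a conjugate because
[wedgeMl] expands it in this way. *)
Definition wedge_bd : E -> T := exterior_lift (fun g h => g * lconj h g^-1).

Lemma wactM k : {morph wact k : l m / l * m}.
Proof.
apply: exterior_liftM => [g g' h|g h h'|g]; last exact: wedge_diag.
- by rewrite lconjM wedgeMl_conj -!lconjJ.
- by rewrite lconjM wedgeMr_conj -!lconjJ.
Qed.

Lemma wact_wedge k g h : wact k (wedge g h) = wedge (lconj k g) (lconj k h).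
Proof.
apply: exterior_lift_wedge => {g h} [g g' h|g h h'|g]; last exact: wedge_diag.
- by rewrite lconjM wedgeMl_conj -!lconjJ.
- by rewrite lconjM wedgeMr_conj -!lconjJ.
Qed.

Lemma wedge_bd_props : {morph wedge_bd : l m / l * m} /\
  (forall g h, wedge_bd (wedge g h) = g * lconj h g^-1).
Proof.
split; [apply: exterior_liftM | apply: exterior_lift_wedge];
  by intros; rewrite /lconj; group_eq.
Qed.

Lemma wedge_bdM : {morph wedge_bd : l m / l * m}.
Proof. by have [] := wedge_bd_props. Qed.

Lemma wedge_bd_wedge g h : wedge_bd (wedge g h) = g * lconj h g^-1.
Proof. by have [] := wedge_bd_props. Qed.

Lemma wedge_bd1 : wedge_bd 1 = 1.
Proof. by apply: (mulgI (wedge_bd 1)); rewrite -wedge_bdM !mulg1. Qed.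

Lemma wedge_bdV l : wedge_bd l^-1 = (wedge_bd l)^-1.
Proof. by apply/esym/mulg1_eq; rewrite -wedge_bdM mulgV wedge_bd1. Qed.

Lemma wact_1 k : wact k 1 = 1.
Proof. by apply: (mulgI (wact k 1)); rewrite -wactM !mulg1. Qed.

Lemma wactV k l : wact k l^-1 = (wact k l)^-1.
Proof. by apply/esym/mulg1_eq; rewrite -wactM mulgV wact_1. Qed.

Lemma wact1 l : wact 1 l = l.
Proof.
apply: (exterior_morph_eq (@wactM 1) (f' := id)) => // g h.
by rewrite wact_wedge !lconj1g.
Qed.

Lemma wactA g h l : wact (g * h) l = wact g (wact h l).
Proof.
apply: (exterior_morph_eq (@wactM _) (f' := wact g \o wact h)) => [m n|a b] /=.
  by rewrite !wactM.
by rewrite !wact_wedge !lconjA.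
Qed.

Lemma wactK g l : wact g^-1 (wact g l) = l.
Proof. by rewrite -wactA mulVg wact1. Qed.

Lemma wedgeMl g g' h : wedge (g * g') h = wact g (wedge g' h) * wedge g h.
Proof. by rewrite wact_wedge wedgeMl_conj. Qed.

Lemma wedgeMr g h h' : wedge g (h * h') = wedge g h * wact h (wedge g h').
Proof. by rewrite wact_wedge wedgeMr_conj. Qed.

(** For l = g' ^ h' this compares the two ways of expanding g g' ^ h h' with the
defining relations. *)
Lemma peiffer_wedge g h l :
  wedge g h * wact (h * g) l * (wedge g h)^-1 = wact (g * h) l.
Proof.
apply: (exterior_morph_eq
  (f := fun l => wedge g h * wact (h * g) l * (wedge g h)^-1))
  => [m n|//|g' h'].
- by rewrite wactM; group_eq.
- exact: wactM.
have : wedge (g * g') (h * h') = wedge (g * g') (h * h') by [].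
rewrite {1}wedgeMl !wedgeMr {1}wedgeMl !wactM !(wedgeMl g g') !wactM -!wactA.
rewrite -!mulgA => /mulgI; rewrite !mulgA => /mulIg <-; group_eq.
Qed.

(** The Peiffer identity: conjugation in the exterior square is the action of
the commutator, so subgroups stable under the action are normal. *)
Lemma peiffer l m : l * m * l^-1 = wact (wedge_bd l) m.
Proof.
elim/exterior_ind: l m => [|g h m].
  split=> [m|l l' IHl IHl' m|l IHl m].
  - by rewrite wedge_bd1 wact1; group_eq.
  - by rewrite wedge_bdM wactA -IHl -IHl'; group_eq.
  - have /(congr1 (wact (wedge_bd l)^-1)) := IHl (l^-1 * m * l).
    by rewrite wactK wedge_bdV invgK => <-; congr wact; group_eq.
have := peiffer_wedge g h (wact (h * g)^-1 m).
rewrite -!wactA mulgV wact1 => ->; rewrite wedge_bd_wedge /lconj.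
by congr wact; group_eq.
Qed.

Lemma wedge1g h : wedge 1 h = 1.
Proof.
apply: (mulIg (wedge 1 h)).
by rewrite -{1}(wact1 (wedge 1 h)) -wedgeMl !mul1g.
Qed.

Lemma wedgeg1 g : wedge g 1 = 1.
Proof.
apply: (mulgI (wedge g 1)).
by rewrite -{2}(wact1 (wedge g 1)) -wedgeMr !mulg1.
Qed.

Lemma wact_wedgeVl g h : wact g (wedge g^-1 h) = (wedge g h)^-1.
Proof.
apply/esym/mulg1_eq/(mulIg (wedge g h)).
by rewrite -mulgA -wedgeMl mulgV wedge1g mulg1 mul1g.
Qed.

Lemma wact_wedgeVr g h : wact h (wedge g h^-1) = (wedge g h)^-1.
Proof. by apply/esym/mulg1_eq; rewrite -wedgeMr mulgV wedgeg1. Qed.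

(** From gh ^ gh = 1. *)
Lemma wedgeC g h : wedge h g = (wedge g h)^-1.
Proof.
have := wedge_diag (g * h).
rewrite wedgeMl (wedgeMr h) wedge_diag wact_1 mulg1.
rewrite (wedgeMr g g) wedge_diag mul1g -wactM -(wact_1 g).
by move=> /(can_inj (wactK g))/mulg1_eq <-; rewrite invgK.
Qed.

(** Expand g (h g^-1 h^-1) ^ k, after writing h g^-1 h^-1 ^ k as the image under
h of g^-1 ^ h^-1 k h; the conjugation by g ^ k that appears is an action, by
[peiffer]. *)
Lemma wedge_bd_wedgel g h k :
  wedge (wedge_bd (wedge g h)) k = wedge g h * (wact k (wedge g h))^-1.
Proof.
rewrite wedge_bd_wedge wedgeMl.
have -> : wedge (lconj h g^-1) k = wact h (wedge g^-1 (h^-1 * (k * h))).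
  by rewrite wact_wedge; congr wedge; rewrite /lconj; group_eq.
rewrite wedgeMr (wedgeMr _ k) !wactM -!wactA.
have -> : wact (g * h) (wedge g^-1 h^-1) = wedge g h.
  by rewrite wactA wact_wedgeVr wactV wact_wedgeVl invgK.
rewrite !(mulgA, mulgK) wact_wedgeVl -!mulgA; congr (_ * _).
rewrite -wactV -(wact_wedgeVl g h) -wactA mulgA.
have := peiffer (wedge g k)^-1 (wact (g * k) (wedge g^-1 h)).
rewrite invgK -wactA => ->; congr wact.
by rewrite wedge_bdV wedge_bd_wedge /lconj; group_eq.
Qed.

(** Both sides are crossed homomorphisms in l, and they agree on generators by
[wedge_bd_wedgel] and [wedgeC]. *)
Lemma wedge_bdr k l : wedge k (wedge_bd l) = wact k l * l^-1.
Proof.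
elim/exterior_ind: l => [|g h]; last first.
  by rewrite wedgeC wedge_bd_wedgel; group_eq.
have wM l m : wedge k (wedge_bd l) = wact k l * l^-1 ->
    wedge k (wedge_bd (l * m)) = wact k l * wedge k (wedge_bd m) * l^-1.
  by move=> eql; rewrite wedge_bdM wedgeMr eql -peiffer; group_eq.
split=> [|l m el em|l el].
- by rewrite wedge_bd1 wedgeg1 wact_1 invg1 mulg1.
- by rewrite wM // em wactM; group_eq.
have := wM l l^-1 el; rewrite mulgV wedge_bd1 wedgeg1 wactV invgK => e1.
apply: (mulgI (wact k l)); apply: (mulIg l^-1); rewrite -e1.
by group_eq.
Qed.

End ExteriorSquareCalculus.

(** * The lower central filtration of the exterior square *)

Lemma mem_commg_subgroup (gT : finGroupType) (A B : {set gT}) (D : gT -> Prop) :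
    is_subgroup D -> (forall a b, a \in A -> b \in B -> D [~ a, b]) ->
  forall k, k \in [~: A, B] -> D k.
Proof.
move=> [D1 DM _] Dc k kAB.
have grpD : group_set [set x | `[< D x >]].
  apply/group_setP; split=> [|x y]; rewrite !inE; first exact/asboolP.
  by move=> /asboolP Dx /asboolP Dy; apply/asboolP/DM.
have /subsetP/(_ k kAB) : [~: A, B] \subset Group grpD.
  rewrite gen_subG; apply/subsetP=> _ /imset2P[a b Aa Bb ->].
  by rewrite inE; apply/asboolP/Dc.
by rewrite inE => /asboolP.
Qed.

Section Filtration.
Variable gT : finGroupType.
Local Notation E := (exterior_square gT).
Local Notation "''L_' i" := ('L_i([set: gT]))
  (at level 8, i at level 2, format "''L_' i").
Implicit Types (g h k : gT) (l m : E) (i j : nat).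

Definition wedge_filt i : E -> Prop :=
  generated_by (fun l => exists h g, g \in 'L_i /\ l = wedge h g).
Local Notation M := wedge_filt.

Lemma wedge_filt_in i h g : g \in 'L_i -> M i (wedge h g).
Proof. by move=> Lg; apply: generated_in; exists h, g. Qed.

Lemma wedge_filtl i h g : g \in 'L_i -> M i (wedge g h).
Proof. by move=> Lg; rewrite wedgeC; apply/generatedV/wedge_filt_in. Qed.

Lemma lcn_lconj i g h : g \in 'L_i -> lconj h g \in 'L_i.
Proof.
move=> Lg; have -> : lconj h g = g ^ h^-1 by rewrite /lconj; group_eq.
by rewrite memJ_norm // (subsetP (normal_norm (lcn_normal _ _))) ?inE.
Qed.

Lemma wedge_filt_ind i (D : E -> Prop) : is_subgroup D ->
  (forall h g, g \in 'L_i -> D (wedge h g)) -> forall l, M i l -> D l.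
Proof.
by move=> subD Dw; apply: generated_min => // _ [h [g [Lg ->]]]; apply: Dw.
Qed.

Lemma wedge_filt_act i k l : M i l -> M i (wact k l).
Proof.
apply: (wedge_filt_ind (D := fun l => M i (wact k l))) => [|h g Lg].
  split=> [|l1 l2 M1 M2|l1 M1]; first by rewrite wact_1; apply: generated1.
  - by rewrite wactM; apply: generatedM.
  - by rewrite wactV; apply: generatedV.
by rewrite wact_wedge; apply/wedge_filt_in/lcn_lconj.
Qed.

Lemma wedge_filt_conj i l m : M i m -> M i (l * m * l^-1).
Proof. by rewrite peiffer; apply: wedge_filt_act. Qed.

Lemma lcn_dec i g : g \in 'L_i.+1 -> g \in 'L_i.
Proof. exact/subsetP/lcn_sub_leq. Qed.

Lemma wedge_filt_dec i l : M i.+1 l -> M i l.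
Proof.
apply: wedge_filt_ind; first exact: generated_subgroup.
by move=> h g /lcn_dec; apply: wedge_filt_in.
Qed.

Lemma lcn_comm i g h : (0 < i)%N -> g \in 'L_i -> g * lconj h g^-1 \in 'L_i.+1.
Proof.
case: i => // i _ Lg.
have -> : g * lconj h g^-1 = [~ g^-1, h^-1] by rewrite /lconj; group_eq.
by rewrite lcnSn mem_commg ?inE // groupV.
Qed.

Lemma wedge_bd_filt i l : (0 < i)%N -> M i l -> wedge_bd l \in 'L_i.+1.
Proof.
move=> i0; apply: (wedge_filt_ind (D := fun l => wedge_bd l \in 'L_i.+1)).
  split=> [|l1 l2 M1 M2|l1 M1]; rewrite ?wedge_bd1 ?group1 //.
  - by rewrite wedge_bdM groupM.
  - by rewrite wedge_bdV groupV.
move=> h g Lg; rewrite wedgeC wedge_bdV groupV wedge_bd_wedge.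
exact: lcn_comm.
Qed.

(** The three subgroup lemma for the exterior square.  For k = [a, b] the
element g ^ k is the quotient of (g a g^-1) ^ (g b g^-1) by a ^ b.  Writing the
conjugates as a a' and b b' and expanding leaves conjugates of a' ^ (g b g^-1)
and a ^ b'; here a' is in the term of index i + j + 1 and b' in that of index
i + 1, so the induction hypothesis applies to b' ^ a. *)
Lemma wedge_lcn i j g k :
  (0 < i)%N -> g \in 'L_i -> k \in 'L_j.+1 -> M (i + j) (wedge g k).
Proof.
elim: j i g k => [|j IHj] i g k i0 Lg Lk.
  by rewrite addn0; apply: wedge_filtl.
apply: (mem_commg_subgroup (D := fun k => M (i + j.+1)%N (wedge g k))) Lk.
  split=> [|x y Mx My|x Mx]; first by rewrite wedgeg1; apply: generated1.
  - by rewrite wedgeMr; apply: generatedM; [apply: Mx | apply/wedge_filt_act].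
  - rewrite -[wedge _ _](wactK x) wact_wedgeVr; apply: wedge_filt_act.
    exact: generatedV.
move=> {}k b' Lk _; set a := k^-1; set b := b'^-1.
have La : a \in 'L_j.+1 by rewrite groupV.
have -> : [~ k, b'] = wedge_bd (wedge a b).
  by rewrite wedge_bd_wedge /lconj /a /b; group_eq.
pose shift x := lconj x^-1 (g * lconj x g^-1).
have conjE x : lconj g x = x * shift x by rewrite /shift /lconj; group_eq.
have La2 : shift a \in 'L_(i + j.+1).
  apply: lcn_lconj; rewrite addnS -wedge_bd_wedge.
  by apply: wedge_bd_filt; [lia | apply: IHj].
have Lb2 : shift b \in 'L_i.+1 by apply/lcn_lconj/lcn_comm.
rewrite wedge_bdr wact_wedge !conjE wedgeMl (wedgeMr a) -!mulgA.
apply: generatedM; first exact/wedge_filt_act/wedge_filtl.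
rewrite mulgA; apply/wedge_filt_conj/wedge_filt_act.
by rewrite wedgeC; apply: generatedV; rewrite -addSnnS; apply: IHj.
Qed.

(** By [wedge_bdr] the left-hand side is k ^ c with c the commutator of l. *)
Lemma wedge_filt_moves i j k l :
  (0 < i)%N -> (0 < j)%N -> k \in 'L_i -> M j l -> M (i + j) (wact k l * l^-1).
Proof.
by move=> i0 j0 Lk Ml; rewrite -wedge_bdr; apply/wedge_lcn/wedge_bd_filt.
Qed.

Lemma wedge_filt_full l : M 1 l.
Proof.
apply: exterior_ind; first exact: generated_subgroup.
by move=> g h; apply: wedge_filt_in; rewrite inE.
Qed.

Lemma wedge_filt_N_series : N_series M.
Proof.
split=> [i|i l|]; [exact: generated_subgroup | exact: wedge_filt_dec |].
have pos i j l m : (0 < i)%N -> (0 < j)%N -> M i l -> M j m ->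
    M (i + j) [~ l, m].
  move=> i0 j0 Ml Mm; have -> : [~ l, m] = wact (wedge_bd l^-1) m^-1 * m^-1^-1.
    by rewrite -peiffer; group_eq.
  apply/wedge_filt_dec; rewrite -addSn; apply: wedge_filt_moves => //.
    by apply: wedge_bd_filt => //; apply: generatedV.
  exact: generatedV.
move=> [|i] [|j] l m Ml Mm.
- exact: (wedge_filt_full [~ l, m]).
- by apply: wedge_filt_dec; apply: (pos 1%N); rewrite // wedge_filt_full.
- apply: wedge_filt_dec; rewrite -addnS.
  by apply: pos => //; apply: wedge_filt_full.
- exact: pos.
Qed.

(** The derivative of n |-> x^n.u is n |-> x^n.u' with u' = u^-1 (x.u), which
is i steps deeper than u. *)
Lemma poly_wact i x u : (0 < i)%N -> x \in 'L_i ->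
  forall r j, M (i * j.+1) u ->
  poly_upto (fun j => M (i * j)%N) r j.+1 (fun n => wact (x ^+ n) u).
Proof.
move=> i0 Lx r; elim: r u => [|r IHr] u j Mu; split=> //;
  try by move=> n; apply: wedge_filt_act.
apply: (@poly_upto_ext _ _ _ _ (fun n => wact (x ^+ n) (u^-1 * wact x u))).
  by move=> n; rewrite /diff_seq expgSr wactA wactM wactV.
apply: IHr; rewrite mulnS.
have -> : u^-1 * wact x u = u^-1 * (wact x u * u^-1) * u^-1^-1 by group_eq.
by apply/wedge_filt_conj/wedge_filt_moves => //; lia.
Qed.

(** The derivative of n |-> y ^ x^n is n |-> x^n.(y ^ x), so this sequence is
polynomial; it vanishes at multiples of the exponent, and the Hall-Petresco
formula identifies its value there with (y ^ x)^n. *)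
Lemma wedge_filt_expg i n : (0 < i)%N -> exponent [set: gT] %| n ->
  binomials_kill M n i -> forall l, M i l -> l ^+ n = 1.
Proof.
move=> i0 exp_n kill l Ml.
suff : M i l /\ l ^+ n = 1 by case.
move: l Ml; apply: wedge_filt_ind.
  split=> [|l m [Ml ln] [Mm mn]|l [Ml ln]].
  - by rewrite expg1n; split=> //; apply: generated1.
  - rewrite (expgM_kill wedge_filt_N_series kill) // ln mn mulg1.
    by split=> //; apply: generatedM.
  - by rewrite expVgn ln invg1; split=> //; apply: generatedV.
move=> y x Lx; split; first exact: wedge_filt_in.
have serF := N_series_multiples wedge_filt_N_series i.
have := hall_petresco serF (g := fun d => wedge y (x ^+ d)) _ _ kill.
rewrite (exponentP exp_n) ?inE // wedgeg1 expg1 => <- // r.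
case: r => [|r].
  by split=> // m; rewrite muln0; apply/wedge_filt_dec/wedge_filt_full.
split=> [m|]; first by rewrite muln0; apply/wedge_filt_dec/wedge_filt_full.
apply: (@poly_upto_ext _ _ _ _ (fun d => wact (x ^+ d) (wedge y x))).
  by move=> m; rewrite /diff_seq expgSr wedgeMr mulKg.
by apply: poly_wact; rewrite // muln1; apply: wedge_filt_in.
Qed.

End Filtration.

Theorem exterior_square_expg (p : nat) (gT : finGroupType) :
  prime p -> p.-group [set: gT] -> nil_class [set: gT] <= p ^ 2 - 1 ->
  forall l : exterior_square gT, l ^+ (p * exponent [set: gT]) = 1.
Proof.
move=> p_pr pG cl l.
have [e exp_e] : {e | exponent [set: gT] = (p ^ e)%N}.
  by apply: p_natP; rewrite pnat_exponent.
rewrite exp_e -expnS.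
apply: (exponent_bound p_pr (wedge_filt_N_series gT)) (wedge_filt_full l).
  have L1 : 'L_(p ^ 2)([set: gT]) = 1.
    have /lcn_nil_classP := cl; move/(_ (pgroup_nil pG)).
    by rewrite subn1 prednK ?expn_gt0 ?prime_gt0.
  apply: wedge_filt_ind.
    by split=> [|y z -> ->|y ->]; rewrite ?mulg1 ?invg1.
  by move=> h g; rewrite L1 => /set1gP->; rewrite wedgeg1.
by move=> i n i0; rewrite -exp_e; apply: wedge_filt_expg.
Qed.

(** * From the exterior square to central extensions *)

Section ProjectiveLift.
Variables (T K : groupType) (s : T -> K).

Definition central (z : K) := forall x, z * x = x * z.

Hypothesis sM : forall g h, exists2 z, central z & s g * s h = z * s (g * h).

(** The commutator of s(g) and s(h), in the form used by [wedge_bd]. *)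
Definition comm_lift g h := s g * lconj (s h) (s g)^-1.

Lemma centralV z : central z -> central z^-1.
Proof. by move=> cz x; exact: (esym (commuteV (esym (cz x)))). Qed.

Lemma centralM z w : central z -> central w -> central (z * w).
Proof. by move=> cz cw x; rewrite -mulgA (cw x) mulgA (cz x) mulgA. Qed.

Lemma comm_centrall z x y : central z ->
  (z * x) * lconj y (z * x)^-1 = x * lconj y x^-1.
Proof.
move=> cz; rewrite (cz x) /lconj; group_eq.
by rewrite -(mulgA x z) (cz y); group_eq.
Qed.

Lemma comm_centralr z x y : central z ->
  x * lconj (z * y) x^-1 = x * lconj y x^-1.
Proof.
move=> cz; rewrite (cz y) /lconj; group_eq.
by rewrite -(mulgA (x * y) z) (cz x^-1); group_eq.
Qed.

Lemma lift_lconj k g :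
  exists2 z, central z & s (lconj k g) = z * lconj (s k) (s g).
Proof.
have [z cz ez] := sM k g; have [w cw ew] := sM (lconj k g) k.
exists (w * z^-1); first by apply: centralM => //; apply: centralV.
apply: (mulIg (s k)); rewrite ew /lconj; group_eq.
by rewrite -[RHS]mulgA ez; group_eq.
Qed.

Lemma comm_lift_lconj k g h :
  comm_lift (lconj k g) (lconj k h) = lconj (s k) (comm_lift g h).
Proof.
rewrite /comm_lift; have [z cz ->] := lift_lconj k g.
have [w cw ->] := lift_lconj k h.
by rewrite comm_centralr // comm_centrall // /lconj; group_eq.
Qed.

(** Commutators do not see central factors, so a section that is multiplicative
up to the centre turns the relations of the exterior square into commutator
identities. *)
Lemma exterior_lift_exists : exists2 phi : exterior_square T -> K,
  {morph phi : l m / l * m} & forall g h, phi (wedge g h) = comm_lift g h.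
Proof.
exists (exterior_lift comm_lift);
  [apply: exterior_liftM | apply: exterior_lift_wedge];
  first [move=> g g' h; rewrite comm_lift_lconj /comm_lift;
    have [z cz e] := sM g g';
    by rewrite -(comm_centrall (s (g * g')) (s h) cz) -e /lconj; group_eq
  | move=> g h h'; rewrite comm_lift_lconj /comm_lift;
    have [z cz e] := sM h h';
    by rewrite -(comm_centralr (s g) (s (h * h')) cz) -e /lconj; group_eq
  | by move=> g; rewrite /comm_lift /lconj; group_eq].
Qed.
End ProjectiveLift.

(** * Abelian quotients *)

Section Abelianization.
Variables (K : groupType) (C : K -> Prop).
Hypothesis subC : is_subgroup C.
Hypothesis commC : forall x y, C [~ x, y].

Let C1 : C 1. Proof. by have [] := subC. Qed.
Let CM x y : C x -> C y -> C (x * y).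
Proof. by have [_ h _] := subC; apply: h. Qed.
Let CV x : C x -> C x^-1. Proof. by have [_ _ h] := subC; apply: h. Qed.
Let CJ x y : C x -> C (x ^ y).
Proof. by move=> Cx; rewrite -(mulKVg x (x ^ y)) -commgEl; apply: CM. Qed.
Lemma subgroup_swap x y : C (x * y) -> C (y * x).
Proof. by move=> /(CJ x); rewrite conjgE mulgA mulKg. Qed.

Definition ab_eqb : rel K := fun x y => `[< C (x * y^-1) >].

Lemma ab_eqb_is_equiv : equiv_class_of ab_eqb.
Proof.
split=> [x|x y|y x z]; first by apply/asboolP; rewrite mulgV.
- by apply/asboolP/asboolP => /CV; rewrite invMg invgK.
- move=> /asboolP Cxy /asboolP Cyz; apply/asboolP.
  by have := CM Cxy Cyz; rewrite mulgA mulgVK.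
Qed.

Canonical ab_eqb_equiv := EquivRelPack ab_eqb_is_equiv.
Canonical ab_eqb_encModRel := defaultEncModRel ab_eqb.
(** The proof argument makes the quotient depend on the commutativity of its
group law, so that its instances can be found from the type alone. *)
Definition abquot_of (_ : forall x y, C [~ x, y]) := {eq_quot ab_eqb}%qT.
Local Notation abquot := (abquot_of commC).
HB.instance Definition _ : EqQuotient K ab_eqb abquot := EqQuotient.on abquot.
HB.instance Definition _ := Choice.on abquot.

Definition ab_class (x : K) : abquot := (\pi_abquot x)%qT.

Lemma ab_classP x y : ab_class x = ab_class y <-> C (x * y^-1).
Proof.
split; first by move=> /eqmodP/asboolP.
by move=> xy; apply/eqmodP/asboolP.
Qed.

Let qrepr : abquot -> K := generic_quotient.repr.
Lemma ab_classK a : ab_class (qrepr a) = a. Proof. exact: reprK. Qed.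

Definition ab_add a b := ab_class (qrepr a * qrepr b).
Definition ab_opp a := ab_class (qrepr a)^-1.

Lemma ab_addE x y : ab_add (ab_class x) (ab_class y) = ab_class (x * y).
Proof.
have /ab_classP Cx := ab_classK (ab_class x).
have /ab_classP Cy := ab_classK (ab_class y).
apply/ab_classP; rewrite invMg mulgA; apply/subgroup_swap.
set a := qrepr _ in Cx *; set b := qrepr _ in Cy *.
have -> : x^-1 * (a * b * y^-1) = x^-1 * a * (b * y^-1) by group_eq.
exact/CM/Cy/subgroup_swap.
Qed.

Lemma ab_oppE x : ab_opp (ab_class x) = ab_class x^-1.
Proof.
have /ab_classP Cx := ab_classK (ab_class x).
apply/ab_classP; rewrite invgK; apply: subgroup_swap.
by have := CV Cx; rewrite invMg invgK.
Qed.

Lemma ab_ind (P : abquot -> Prop) : (forall x, P (ab_class x)) -> forall a, P a.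
Proof. by move=> Px a; rewrite -(ab_classK a). Qed.

Lemma ab_addA : associative ab_add.
Proof. by do 3!elim/ab_ind=> ?; rewrite !ab_addE mulgA. Qed.

Lemma ab_addC : commutative ab_add.
Proof.
elim/ab_ind=> x; elim/ab_ind=> y; rewrite !ab_addE; apply/ab_classP.
by have -> : x * y * (y * x)^-1 = [~ x^-1, y^-1] by group_eq.
Qed.

Lemma ab_add0 : left_id (ab_class 1) ab_add.
Proof. by elim/ab_ind=> x; rewrite ab_addE mul1g. Qed.

Lemma ab_addN : left_inverse (ab_class 1) ab_opp ab_add.
Proof. by elim/ab_ind=> x; rewrite ab_oppE ab_addE mulVg. Qed.

HB.instance Definition _ :=
  GRing.isZmodule.Build abquot ab_addA ab_addC ab_add0 ab_addN.

Lemma ab_class_eq0 x : (ab_class x = 0)%R <-> C x.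
Proof. by rewrite -[0%R]/(ab_class 1) ab_classP invg1 mulg1. Qed.

Lemma ab_classM x y : ab_class (x * y) = (ab_class x + ab_class y)%R.
Proof. by rewrite -ab_addE. Qed.

End Abelianization.

(** * The central extension of a 2-cocycle *)

Section CocycleExtension.
Variables (T : groupType) (A : zmodType) (f : T -> T -> A).
Local Open Scope ring_scope.

Definition cocycle2 := forall g h k,
  f h k - f (g * h)%g k + f g (h * k)%g - f g h = 0.

(** The proof argument records the cocycle identity, which the group law
needs. *)
Definition extension (_ : cocycle2) : Type := (A * T)%type.

Variable coc : cocycle2.
Local Notation H := (extension coc).
HB.instance Definition _ := Choice.on H.

Lemma cocycleE g h k : f g h + f (g * h)%g k = f h k + f g (h * k)%g.
Proof.
by have /eqP := coc g h k; rewrite subr_eq0 => /eqP <-; rewrite addrAC subrK.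
Qed.

Lemma cocycle1r k : f 1%g k = f 1%g 1%g.
Proof. by have := cocycleE 1 1 k; rewrite !mul1g => /addIr. Qed.

Lemma cocycler1 g : f g 1%g = f 1%g 1%g.
Proof. by have := cocycleE g 1 1; rewrite !mulg1 => /addIr. Qed.

Lemma cocycleVV g : f g g^-1%g = f g^-1%g g.
Proof.
have := cocycleE g g^-1 g.
by rewrite mulgV mulVg cocycle1r cocycler1 => /addIr.
Qed.

Definition ext_mul (x y : H) : H := (x.1 + y.1 + f x.2 y.2, (x.2 * y.2)%g).
(** The cocycle need not be normalised: its value at (1, 1) corrects the unit,
the inverse and the inclusion of A. *)
Definition ext_one : H := (- f 1%g 1%g, 1%g).
Definition ext_inv (x : H) : H :=
  (- x.1 - f x.2 x.2^-1%g - f 1%g 1%g, x.2^-1%g).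

Lemma ext_mulA : associative ext_mul.
Proof.
move=> [a g] [b h] [c k]; congr pair; rewrite /= ?mulgA //.
by rewrite (addrAC (a + b)) -[RHS]addrA cocycleE !addrA.
Qed.

Lemma ext_mul1g : left_id ext_one ext_mul.
Proof.
by move=> [a g]; congr pair; rewrite /= ?mul1g // cocycle1r addrAC addNr add0r.
Qed.

Lemma ext_mulg1 : right_id ext_one ext_mul.
Proof. by move=> [a g]; congr pair; rewrite /= ?mulg1 // cocycler1 subrK. Qed.

Lemma ext_mulVg : left_inverse ext_one ext_inv ext_mul.
Proof.
move=> [a g]; congr pair; rewrite /= ?mulVg // -cocycleVV.
by rewrite -opprD -addrA addrAC addNr add0r.
Qed.

Lemma ext_mulgV : right_inverse ext_one ext_inv ext_mul.
Proof.
move=> [a g]; congr pair; rewrite /= ?mulgV //.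
by rewrite -!addrA addNKr addrCA addNr addr0.
Qed.

HB.instance Definition _ := isGroup.Build H
  ext_mulA ext_mul1g ext_mulg1 ext_mulVg ext_mulgV.

Definition ext_section (g : T) : H := (0, g).
Definition ext_incl (a : A) : H := (a - f 1%g 1%g, 1%g).

Lemma ext_inclD a b : ext_incl (a + b) = (ext_incl a * ext_incl b)%g.
Proof.
apply: (congr2 pair); rewrite /= ?mulg1 //.
by rewrite [in RHS]addrA subrK addrAC.
Qed.

Lemma ext_incl_mul a (x : H) : (ext_incl a * x)%g = (a + x.1, x.2) :> H.
Proof.
by apply: (congr2 pair); rewrite /= ?mul1g // cocycle1r [a - _ + _]addrAC subrK.
Qed.

Lemma ext_incl_central a : central (ext_incl a).
Proof.
move=> x; rewrite ext_incl_mul; apply: (congr2 pair); rewrite /= ?mulg1 //.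
by rewrite cocycler1 addrA subrK addrC.
Qed.

Lemma ext_split (x : H) : x = (ext_incl x.1 * ext_section x.2)%g.
Proof. by rewrite ext_incl_mul addr0; case: x. Qed.

Lemma ext_sectionM g h :
  (ext_section g * ext_section h = ext_incl (f g h) * ext_section (g * h))%g.
Proof.
by rewrite ext_incl_mul; apply: (congr2 pair); rewrite //= addr0 add0r addr0.
Qed.

Lemma ext_incl0 : ext_incl 0 = 1%g.
Proof. by apply: (congr2 pair); rewrite // add0r. Qed.

Lemma ext_incl_eq1 a : ext_incl a = 1%g -> a = 0.
Proof. by case=> /(congr1 (+%R^~ (f 1%g 1%g))); rewrite subrK addNr. Qed.

Lemma ext_inclX a n : ext_incl (a *+ n) = (ext_incl a ^+ n)%g.
Proof.
elim: n => [|n IHn]; first by rewrite mulr0n ext_incl0.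
by rewrite mulrS ext_inclD IHn expgS.
Qed.

End CocycleExtension.

(** * The second homology group *)

Lemma free_ext_morph (I : finType) (A B : zmodType) (f : I -> A)
    (d : A -> B) c :
    {morph d : a b / (a + b)%R} ->
  d (free_ext f c) = free_ext (d \o f) c.
Proof.
move=> dD; have d0 : d 0%R = 0%R by apply: (addrI (d 0%R)); rewrite -dD !addr0.
have dB : zmod_morphism d.
  move=> a b; apply: (addIr (d b)); rewrite -dD !subrK //.
pose D : {additive A -> B} :=
  HB.pack d (GRing.isZmodMorphism.Build A B d dB).
rewrite -[d]/(D : A -> B) /free_ext raddf_sum; apply: eq_bigr => i _.
by rewrite raddfMz.
Qed.

Lemma free_ext_gen_id (I : finType) (c : free_ab I) :
  free_ext (@free_gen I) c = c.
Proof.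
apply/ffunP=> t; pose ev (b : free_ab I) : int := b t.
rewrite -[LHS]/(ev _) free_ext_morph => [|a b]; last by rewrite /ev ffunE.
rewrite /free_ext (bigD1 t) //= big1 => [|u /negPf ut].
  by rewrite /ev ffunE eqxx addr0 intz.
by rewrite /ev ffunE eq_sym ut mul0rz.
Qed.

(** Let C be the image of the exterior square in the extension H; it contains
all commutators.  In H / C, additively, f(g,h) becomes s(g) + s(h) - s(gh), that
is s applied to the boundary of (g,h), so the image of a cycle is in C, whose
elements are killed by N. *)
Theorem cocycle_cycle_mulrn (gT : finGroupType) (A : zmodType)
    (f : gT -> gT -> A) (N : nat) :
    cocycle2 f -> (forall l : exterior_square gT, l ^+ N = 1) ->
  forall c : bar2 gT, bar_d2 c = 0%R ->
  (free_ext (fun t => f t.1 t.2) c *+ N = 0)%R.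
Proof.
move=> coc expN c c_cycle.
have secM g h : exists2 z, central z &
    ext_section coc g * ext_section coc h = z * ext_section coc (g * h).
  exists (ext_incl coc (f g h)); first exact: ext_incl_central.
  exact: ext_sectionM.
have [phi phiM phiw] := exterior_lift_exists secM.
have phi1 : phi 1 = 1 by apply: (mulgI (phi 1)); rewrite -phiM !mulg1.
have phiX l n : phi (l ^+ n) = phi l ^+ n.
  by elim: n => [|n IHn]; rewrite ?expg0 // !expgS phiM IHn.
pose C x := exists l, x = phi l.
have subC : is_subgroup C.
  split=> [|_ _ [l ->] [m ->]|_ [l ->]]; first by exists 1.
    by exists (l * m).
  by exists l^-1; apply/mulg1_eq; rewrite -phiM mulgV.
have commC x y : C [~ x, y].
  have -> : [~ x, y] = x^-1 * lconj y^-1 x^-1^-1 by rewrite /lconj; group_eq.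
  rewrite (ext_split x^-1) (ext_split y^-1).
  rewrite comm_centralr ?comm_centrall; try exact: ext_incl_central.
  by exists (wedge (x^-1).2 (y^-1).2); rewrite phiw.
pose Q := abquot_of subC commC; pose q := ab_class subC commC : _ -> Q.
have qM x y : q (x * y) = (q x + q y)%R by apply: ab_classM.
have : q (ext_incl coc (free_ext (fun t => f t.1 t.2) c)) = 0%R.
  have qiD : {morph q \o ext_incl coc : a b / (a + b)%R}.
    by move=> a b; rewrite /= ext_inclD qM.
  rewrite [LHS](free_ext_morph _ c qiD).
  rewrite -[RHS](raddf0 (free_ext (q \o ext_section coc))) -c_cycle.
  rewrite /bar_d2 [in RHS]/free_ext raddf_sum; apply: eq_bigr => -[g h] _.
  rewrite raddfMz; congr (_ *~ _)%R.
  rewrite !(raddfB, raddfD) /= !free_ext_gen /=.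
  apply: (addIr (q (ext_section coc (g * h)))).
  by rewrite -qM -ext_sectionM qM addrAC subrK addrC.
move=> /ab_class_eq0[l el].
by apply: (ext_incl_eq1 (coc := coc)); rewrite ext_inclX el -phiX expN.
Qed.

Section UniversalCocycle.
Variable gT : finGroupType.
Local Open Scope ring_scope.

Definition is_bar_boundary : pred (bar2 gT) :=
  fun c => `[< exists b, bar_d3 b = c >].

Lemma is_bar_boundary_zmod_closed : zmod_closed is_bar_boundary.
Proof.
split=> [|c d]; rewrite !unfold_in.
  by apply/asboolP; exists 0; rewrite raddf0.
move=> /asboolP[b <-] /asboolP[b' <-]; apply/asboolP.
by exists (b - b'); rewrite raddfB.
Qed.
HB.instance Definition _ :=
  GRing.isZmodClosed.Build (bar2 gT) is_bar_boundary
    is_bar_boundary_zmod_closed.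

Definition chains_mod_boundaries : zmodType :=
  Quotient.quot (GRing.ZmodClosed.clone (bar2 gT) is_bar_boundary _).
Local Notation A := chains_mod_boundaries.

Definition bar_class (c : bar2 gT) : A := (\pi c)%qT.

Lemma bar_class_is_zmod_morphism : zmod_morphism bar_class.
Proof. by move=> c d; rewrite /bar_class !piE. Qed.
HB.instance Definition _ :=
  GRing.isZmodMorphism.Build (bar2 gT) A bar_class bar_class_is_zmod_morphism.

Lemma bar_class_eq0 c : bar_class c = 0 <-> exists b, bar_d3 b = c.
Proof.
rewrite -(raddf0 bar_class); split=> [/eqP|[b bc]].
  by rewrite -Quotient.idealrBE subr0 unfold_in => /asboolP.
apply/eqP; rewrite -Quotient.idealrBE subr0 unfold_in; apply/asboolP.
by exists b.
Qed.

(** The universal 2-cocycle: its cocycle identity says that boundaries vanish. *)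
Definition bar_cocycle (g h : gT) : A := bar_class (free_gen (g, h)).

Lemma bar_cocycle_cocycle : cocycle2 bar_cocycle.
Proof.
move=> g h k; rewrite /bar_cocycle -!(raddfB, raddfD); apply/bar_class_eq0.
by exists (free_gen (g, h, k)); rewrite /bar_d3 free_ext_gen.
Qed.

Lemma bar_cocycle_ext c :
  free_ext (fun t => bar_cocycle t.1 t.2) c = bar_class c.
Proof.
rewrite -{2}[c]free_ext_gen_id free_ext_morph; last exact: raddfD.
by apply: eq_bigr => -[].
Qed.

Theorem homology2_mulrn N : (forall l : exterior_square gT, (l ^+ N = 1)%g) ->
  forall c : homology2 gT, c *+ N = 0.
Proof.
move=> expN c; rewrite -[c]reprK; set z := generic_quotient.repr c.
have z_cycle : bar_d2 (val z) = 0 by have /eqP := valP z.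
have := cocycle_cycle_mulrn bar_cocycle_cocycle expN z_cycle.
rewrite bar_cocycle_ext -raddfMn => /bar_class_eq0 [b bz].
pose cl (x : cycle2 gT) : homology2 gT := (\pi x)%qT.
have cl0 : cl 0 = 0 by rewrite /cl !piE.
have clMn n : cl z *+ n = cl (z *+ n).
  elim: n => [|n IHn]; first by rewrite cl0.
  by rewrite !mulrS IHn /cl !piE.
rewrite -[X in X *+ N]/(cl z) clMn -cl0; apply/eqP.
rewrite -Quotient.idealrBE subr0 unfold_in; apply/asboolP.
by exists b; rewrite bz raddfMn.
Qed.

End UniversalCocycle.

(** * The exponent bounds *)

Lemma least_positive_dvd (P : nat -> Prop) n : (0 < n)%N -> P n ->
    (forall a b, P a -> P b -> P (a %% b)%N) -> least_positive P %| n.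
Proof.
move=> n0 Pn Pmod; rewrite /least_positive.
case: pselect => [exP|[]]; last by exists n; rewrite n0; apply/asboolP.
case: ex_minnP => m /andP[m0 /asboolP Pm] m_min.
rewrite /dvdn; case: posnP => // r0.
have := m_min (n %% m)%N; rewrite r0 /=.
by have /asboolP -> := Pmod _ _ Pn Pm; move/(_ isT); rewrite leqNgt ltn_pmod.
Qed.

Theorem corollary3p3 (p : nat) (gT : finGroupType) :
  prime p -> odd p -> (p.-group [set: gT])%g ->
  nil_class [set: gT] <= p ^ 2 - 1 ->
  group_exponent (exterior_square gT) %| p * exponent [set: gT] /\
  zmod_exponent (homology2 gT) %| p * exponent [set: gT].
Proof.
move=> p_pr _ pG cl; have expN := exterior_square_expg p_pr pG cl.
have N0 : (0 < p * exponent [set: gT])%N.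
  by rewrite muln_gt0 prime_gt0 //= exponent_gt0.
split; apply: least_positive_dvd => //.
- move=> a b aP bP h; have := aP h.
  by rewrite {1}(divn_eq a b) expgnDr mulnC expgnA bP expg1n mul1g.
- exact: homology2_mulrn.
- move=> a b aP bP c; have := aP c.
  by rewrite {1}(divn_eq a b) mulrnDr mulnC mulrnA bP mul0rn add0r.
Qed.
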